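(* Let $Q\subset\mathbb{R}^d$ be compact and convex, with $D>0$ such that $\|x-y\|\le D$ for all $x,y\in Q$. Let $f$ be $L$-smooth on $Q$, i.e. $L>0$ and $\|\nabla f(x)-\nabla f(y)\|\le L\|x-y\|$ for all $x,y\in Q$; let $f$ be convex on $Q$, i.e. $f(y)\ge f(x)+\langle\nabla f(x),y-x\rangle$ for all $x,y\in Q$; and let the oracle noise be bounded, i.e. $\Delta>0$ and $|\delta(x)|^2\le\Delta^2$ for all $x\in Q$. If $\gamma_k=\frac{4}{k+8d}$, then the deterministic algorithm FW via JAGUAR (see context) has the convergence rate $$\mathbb{E}\big[f(x^N)-f^*\big]=\mathcal{O}\left(\frac{d\max\{LD^2,F_0\}}{N+8d}+\sqrt d\,LD\tau+\frac{\sqrt d\,\Delta D}{\tau}\right),$$ where $f^*:=\min_{x\in Q}f(x)$ and $F_0:=f(x^0)-f^*$.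
   Context: $\|\cdot\|$ is the Euclidean norm on $\mathbb{R}^d$ and $e_1,\dots,e_d$ the standard basis; $\mathcal{O}(\cdot)$ hides an absolute constant. The problem is $\min_{x\in Q}f(x)$ with $f$ differentiable; only a zero-order oracle returning the noisy values $f_\delta(x):=f(x)+\delta(x)$ is available. For a smoothing parameter $\tau>0$ the full approximation of the gradient is $\widetilde\nabla f_\delta(x):=\sum_{i=1}^d\frac{f_\delta(x+\tau e_i)-f_\delta(x-\tau e_i)}{2\tau}e_i$. Deterministic algorithm FW via JAGUAR: start from $x^0\in Q$, $h^0=\widetilde\nabla f_\delta(x^0)$. For $k=0,1,2,\dots$: sample $i_k$ uniformly from $\{1,\dots,d\}$, independently; set $h^{k+1}=h^k-\langle h^k,e_{i_k}\rangle e_{i_k}+\frac{f_\delta(x^k+\tau e_{i_k})-f_\delta(x^k-\tau e_{i_k})}{2\tau}e_{i_k}$; choose $s^k\in\arg\min_{s\in Q}\langle s,h^{k+1}\rangle$; set $x^{k+1}=x^k+\gamma_k(s^k-x^k)$. The expectation is over the random indices.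
   Formalization: Differentiability, L-smoothness of f and the noise bound are assumed on all segments [x−τe_i, x+τe_i] with x in Q, not only on Q: the algorithm queries points outside Q, and with assumptions on Q alone the claimed rate is false. *)

(* Defs.v *)
From HB Require Import structures.
From mathcomp Require Import all_boot all_order all_algebra.
From mathcomp Require Import all_classical all_reals all_analysis.
Set Implicit Arguments.
Unset Strict Implicit.
Unset Printing Implicit Defensive.
Import Order.TTheory GRing.Theory Num.Theory.
Import numFieldNormedType.Exports.
Local Open Scope classical_set_scope.
Local Open Scope ring_scope.

Section Euclidean.
Context {R : realType} {d : nat}.
Implicit Types (x y : 'rV[R]_d) (Q : set 'rV[R]_d) (f : 'rV[R]_d -> R).

(* The library norm `|x| on 'rV[R]_d is the sup norm (it induces the same
   topology), so the Euclidean norm is introduced separately. *)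
Definition dotp x y : R := \sum_(i < d) x 0 i * y 0 i.
Definition enorm x : R := Num.sqrt (dotp x x).

Definition std_basis (i : 'I_d) : 'rV[R]_d := delta_mx 0 i.

Definition gradient f x : 'rV[R]_d := \row_(i < d) 'D_(std_basis i) f x.

Definition lipschitz_gradient_on Q f (L : R) : Prop :=
  forall x y, Q x -> Q y ->
    enorm (gradient f x - gradient f y) <= L * enorm (x - y).

Definition convex_on Q f : Prop :=
  forall x y, Q x -> Q y -> f y >= f x + dotp (gradient f x) (y - x).

(* For compact nonempty Q and continuous f the infimum is attained, so this is
   min_(x in Q) f x. *)
Definition min_on Q f : R := inf (f @` Q).

Definition argmin_on Q f : set 'rV[R]_d :=
  [set s | Q s /\ forall y, Q y -> f s <= f y].

(* Q together with the segments [x - tau e_i, x + tau e_i], x in Q.  A central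
   difference at x in Q evaluates the oracle at the end points of such a
   segment, which in general lie outside Q. *)
Definition stencil_nbhd (tau : R) Q : set 'rV[R]_d :=
  [set y | exists x (i : 'I_d) (t : R),
     [/\ Q x, `|t| <= tau & y = x + t *: std_basis i]].

End Euclidean.

Section Jaguar.
Context {R : realType} {d : nat}.
Implicit Types (f delta g : 'rV[R]_d -> R) (x h : 'rV[R]_d) (i : 'I_d).

Definition noisy f delta x : R := f x + delta x.

Definition central_diff (tau : R) g x i : R :=
  (g (x + tau *: std_basis i) - g (x - tau *: std_basis i)) / (2 * tau).

Definition full_approx (tau : R) g x : 'rV[R]_d :=
  \sum_(i < d) central_diff tau g x i *: std_basis i.

Definition jaguar_update (tau : R) g x h i : 'rV[R]_d :=
  h - dotp h (std_basis i) *: std_basis i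
    + central_diff tau g x i *: std_basis i.

(* The minimiser s k need not be unique.  Any choice is allowed, but it may
   only depend on the indices sampled up to step k. *)
Definition fw_jaguar (Omega : Type) (Q : set 'rV[R]_d) (tau : R) g
    (gamma : nat -> R) (x0 : 'rV[R]_d) (idx : nat -> Omega -> 'I_d)
    (x h s : nat -> Omega -> 'rV[R]_d) : Prop :=
  [/\ forall w, x 0%N w = x0 /\ h 0%N w = full_approx tau g x0,
      forall k w, h k.+1 w = jaguar_update tau g (x k w) (h k w) (idx k w),
      forall k w, argmin_on Q (fun y => dotp y (h k.+1 w)) (s k w),
      forall k w w', (forall j, (j <= k)%N -> idx j w = idx j w') ->
        s k w = s k w' &
      forall k w, x k.+1 w = x k w + gamma k *: (s k w - x k w)].

End Jaguar.

Section Sampling.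
Context {R : realType} {d : nat} {disp : measure_display}
  {Omega : measurableType disp} (P : probability Omega R).
Implicit Type idx : nat -> Omega -> 'I_d.

Definition uniform_indices idx : Prop :=
  forall k (j : 'I_d), measurable (idx k @^-1` [set j]) /\
    P (idx k @^-1` [set j]) = (d%:R^-1)%:E.

Definition independent_indices idx : Prop :=
  forall (J : seq nat) (A : nat -> set 'I_d), uniq J ->
    P (\bigcap_(k in [set` J]) (idx k @^-1` A k)) =
    (\prod_(k <- J) P (idx k @^-1` A k))%E.

End Sampling.

(* Main.v *)
(* With eps = L tau + Delta / tau, each central difference is within eps of the
   partial derivative.  Given the past, a JAGUAR update replaces a uniformly
   chosen coordinate of the estimator, so it contracts the mean squared error
   |h - grad f(x^k)|^2 by 1 - 1/d up to eps^2, while moving from x^k to x^(k+1)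
   adds O(d L^2 D^2 gamma_k^2).  By induction the mean squared error is
   O(d^2 L^2 D^2 / (k + 8d)^2 + d eps^2), and the Frank-Wolfe descent inequality
   turns its square root into the rate for f(x^k) - f^*.  Every random quantity
   up to step k depends on finitely many indices, hence is a simple function on
   the cylinders of the first k indices, which gives measurability and
   independence of the next index. *)
Require Import Defs.
From HB Require Import structures.
From mathcomp Require Import all_boot all_order all_algebra.
From mathcomp Require Import all_classical all_reals all_analysis.
From mathcomp Require Import ring lra.
Set Implicit Arguments.
Unset Strict Implicit.
Unset Printing Implicit Defensive.
Import Order.TTheory GRing.Theory Num.Theory.
Import numFieldNormedType.Exports.
Local Open Scope classical_set_scope.
Local Open Scope ring_scope.

(** * Euclidean inner product and Young's inequality *)

Section DotProduct.
Context {R : realType} {d : nat}.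
Implicit Types (u v w : 'rV[R]_d) (a : R).

Lemma dotpC u v : dotp u v = dotp v u.
Proof. by apply: eq_bigr => i _; rewrite mulrC. Qed.

Lemma dotpDl u v w : dotp (u + v) w = dotp u w + dotp v w.
Proof. by rewrite -big_split; apply: eq_bigr => i _; rewrite mxE mulrDl. Qed.

Lemma dotpZl a u w : dotp (a *: u) w = a * dotp u w.
Proof. by rewrite mulr_sumr; apply: eq_bigr => i _; rewrite mxE mulrA. Qed.

Lemma dotpNl u w : dotp (- u) w = - dotp u w.
Proof. by rewrite -scaleN1r dotpZl mulN1r. Qed.

Lemma dotpDr u v w : dotp w (u + v) = dotp w u + dotp w v.
Proof. by rewrite !(dotpC w) dotpDl. Qed.

Lemma dotpZr a u w : dotp w (a *: u) = a * dotp w u.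
Proof. by rewrite !(dotpC w) dotpZl. Qed.

Lemma dotpNr u w : dotp w (- u) = - dotp w u.
Proof. by rewrite !(dotpC w) dotpNl. Qed.

Definition dotpE := (dotpDl, dotpDr, dotpNl, dotpNr, dotpZl, dotpZr).

Lemma dotp_ge0 u : 0 <= dotp u u.
Proof. by apply: sumr_ge0 => i _; rewrite -expr2 sqr_ge0. Qed.

Lemma dotp_basisr u i : dotp u (std_basis i) = u 0 i.
Proof.
rewrite /dotp (bigD1 i)//= big1 ?addr0 => [|j ji].
  by rewrite mxE !eqxx mulr1.
by rewrite mxE (negPf ji) andbF mulr0.
Qed.

Lemma basisE i j : (std_basis i : 'rV[R]_d) 0 j = (j == i)%:R.
Proof. by rewrite mxE eqxx. Qed.

Lemma coord_sqr_le_dotp u i : u 0 i ^+ 2 <= dotp u u.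
Proof.
rewrite /dotp (bigD1 i)//= -expr2 lerDl; apply: sumr_ge0 => j _.
by rewrite -expr2 sqr_ge0.
Qed.

(** Coordinatewise the two sides differ by [(u 0 i - a * v 0 i) ^+ 2 / (2 * a)]. The free weight [a]
    lets each use balance the two squares. *)
Lemma young_dotp a u v : 0 < a ->
  dotp u v <= dotp u u / (2 * a) + a * dotp v v / 2.
Proof.
move=> a0; rewrite /dotp !mulr_suml mulr_sumr !mulr_suml -big_split /=.
apply: ler_sum => i _; rewrite -subr_ge0.
have -> : u 0 i * u 0 i / (2 * a) + a * (v 0 i * v 0 i) / 2 - u 0 i * v 0 i =
    (u 0 i - a * v 0 i) ^+ 2 / (2 * a) by field; rewrite gt_eqF.
by rewrite divr_ge0 ?sqr_ge0// mulr_ge0// ltW.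
Qed.

Lemma young_dotpD a u v : 0 < a ->
  dotp (u + v) (u + v) <= (1 + a^-1) * dotp u u + (1 + a) * dotp v v.
Proof.
move=> a0; have := young_dotp u v a0; rewrite !dotpE (dotpC v u).
rewrite invfM mulrA (mulrC (_ / 2)) mulrA [a^-1 * _ / _]mulrAC; nra.
Qed.

Lemma enorm_sqr u : enorm u ^+ 2 = dotp u u.
Proof. by rewrite sqr_sqrtr// dotp_ge0. Qed.

Lemma enorm_ge0 u : 0 <= enorm u.
Proof. exact: sqrtr_ge0. Qed.

Lemma enorm_le_sqr u a : enorm u <= a -> dotp u u <= a ^+ 2.
Proof.
move=> ua; rewrite -enorm_sqr ler_sqr// nnegrE ?enorm_ge0//.
exact: le_trans (enorm_ge0 u) ua.
Qed.

End DotProduct.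

(** * Gradients along segments and the error of noisy central differences *)

Section Smoothness.
Context {R : realType} {d : nat}.
Implicit Types (f : 'rV[R]_d -> R) (x y v : 'rV[R]_d) (Q : set 'rV[R]_d).

Lemma derive_gradient f x v : differentiable f x ->
  'D_v f x = dotp (gradient f x) v.
Proof.
move=> df; rewrite deriveE// [in LHS](row_sum_delta v) linear_sum.
by apply: eq_bigr => i _; rewrite linearZ /= mxE deriveE// mulrC.
Qed.

Lemma is_derive_line f x v (t : R) : differentiable f (x + t *: v) ->
  is_derive t 1 (fun t => f (x + t *: v)) (dotp (gradient f (x + t *: v)) v).
Proof.
move=> df.
(* The difference quotient of the restriction to the line is that of [f] at [x + t *: v] in
   direction [v]. *)
have E : (fun h : R => h^-1 *: (((fun t => f (x + t *: v)) \o shift t) (h *: 1)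
     - f (x + t *: v))) =
   (fun h : R => h^-1 *: ((f \o shift (x + t *: v)) (h *: v) - f (x + t *: v))).
  apply/funext => h /=; congr (_ *: (f _ - _)).
  by rewrite [h *: 1]mulr1 scalerDl addrCA.
split.
  rewrite /derivable E; exact: diff_derivable.
by rewrite -derive_gradient// /derive E.
Qed.

Lemma mean_value_line f x v (a b : R) : a <= b ->
  (forall t, a <= t <= b -> differentiable f (x + t *: v)) ->
  exists2 t, a <= t <= b &
    f (x + b *: v) - f (x + a *: v) = dotp (gradient f (x + t *: v)) v * (b - a).
Proof.
move=> ab df.
have D (t : R) : t \in `[a, b] ->
    is_derive t 1 (fun t => f (x + t *: v)) (dotp (gradient f (x + t *: v)) v).
  by rewrite in_itv /= => tab; apply/is_derive_line/df.
have [|c] := MVT_segment ab (fun t (tab : t \in `]a, b[) => D t (subset_itv_oo_cc tab)).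
  by apply: derivable_within_continuous => t /D[].
by rewrite in_itv /= => cab E; exists c.
Qed.

Lemma lipschitz_gradient_sqr Q f (L : R) x y : lipschitz_gradient_on Q f L ->
  Q x -> Q y ->
  dotp (gradient f x - gradient f y) (gradient f x - gradient f y) <=
  L ^+ 2 * dotp (x - y) (x - y).
Proof.
move=> lip Qx Qy; rewrite -(enorm_sqr (x - y)) -exprMn.
exact/enorm_le_sqr/lip.
Qed.

(* Young's inequality replaces Cauchy-Schwarz, at the cost of the constant
   [L] instead of the sharp [L / 2]. *)
Lemma descent_lemma Q f (L : R) x v : 0 < L -> lipschitz_gradient_on Q f L ->
  (forall y, Q y -> differentiable f y) ->
  (forall t, 0 <= t <= 1 -> Q (x + t *: v)) ->
  f (x + v) <= f x + dotp (gradient f x) v + L * dotp v v.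
Proof.
move=> L0 lip df Qv.
have [t t01] := @mean_value_line f x v 0 1 ler01 (fun t ht => df _ (Qv t ht)).
rewrite scale0r addr0 scale1r subr0 mulr1 => /eqP; rewrite subr_eq => /eqP ->.
have Qx : Q x by rewrite -[x]addr0 -[0](scale0r v); apply: Qv; rewrite lexx ler01.
have /= := lipschitz_gradient_sqr lip (Qv t t01) Qx.
set w := gradient f (x + _) - _ => hw.
(* [w] is the change of the gradient from [x] to the intermediate point. The Lipschitz bound gives
   [dotp w w <= L ^+ 2 * dotp v v], so Young's inequality with weight [L] yields two halves of
   [L * dotp v v]. *)
have -> : gradient f (x + t *: v) = gradient f x + w by rewrite /w addrCA subrr addr0.
have := @young_dotp _ _ L w v L0; rewrite dotpDl.
have xtx : x + t *: v - x = t *: v by rewrite addrAC subrr add0r.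
rewrite xtx dotpZl dotpZr in hw.
have : dotp w w / (2 * L) <= L * dotp v v / 2.
  rewrite ler_pdivrMr ?mulr_gt0//; apply: le_trans hw _.
  have -> : L * dotp v v / 2 * (2 * L) = L ^+ 2 * dotp v v by field.
  apply: ler_wpM2l; first exact: sqr_ge0.
  case/andP: t01 => t0 t1.
  by rewrite mulrA ler_piMl ?dotp_ge0// mulr_ile1.
lra.
Qed.

(** By the mean value theorem the noiseless quotient is a partial derivative at a point within [tau]
    of [x], hence off by at most [L * tau]; the two noise values add at most
    [2 * Delta / (2 * tau)]. *)
Lemma central_diff_error Q f (delta : 'rV[R]_d -> R) (L Delta tau : R) x i :
  0 < tau -> 0 < L -> lipschitz_gradient_on (stencil_nbhd tau Q) f L ->
  (forall y, stencil_nbhd tau Q y -> differentiable f y) ->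
  0 < Delta ->
  (forall y, stencil_nbhd tau Q y -> `|delta y| ^+ 2 <= Delta ^+ 2) ->
  Q x ->
  `|central_diff tau (noisy f delta) x i - gradient f x 0 i| <=
    L * tau + Delta / tau.
Proof.
move=> tau0 L0 lip df Delta0 hd Qx.
have S t : - tau <= t <= tau -> stencil_nbhd tau Q (x + t *: std_basis i).
  by move=> ht; exists x, i, t; split=> //; rewrite ler_norml.
have Sx : stencil_nbhd tau Q x.
  by rewrite -[x]addr0 -[0](scale0r (std_basis i)); apply: S; rewrite oppr_le0 ltW.
have [|t ht] := @mean_value_line f x (std_basis i) (- tau) tau _
  (fun t ht => df _ (S t ht)); first by rewrite ge0_cp// ltW.
rewrite scaleNr dotp_basisr => E.
have nd y : stencil_nbhd tau Q y -> `|delta y| <= Delta.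
  by move=> /hd; rewrite ler_sqr// nnegrE ltW.
have d1 := nd _ (S tau _); have d2 := nd _ (S (- tau) _).
rewrite scaleNr in d2.
have G : `|gradient f (x + t *: std_basis i) 0 i - gradient f x 0 i| <= L * tau.
  have := lipschitz_gradient_sqr lip (S t ht) Sx.
  have -> : x + t *: std_basis i - x = t *: std_basis i.
    by rewrite addrAC subrr add0r.
  have -> : dotp (t *: std_basis i) (t *: std_basis i) = t ^+ 2 :> R.
    by rewrite !dotpE dotp_basisr basisE eqxx mulr1 expr2.
  move=> /(le_trans (coord_sqr_le_dotp _ i)); rewrite [X in X ^+ 2]mxE.
  rewrite [X in _ + X]mxE => h.
  rewrite -ler_sqr ?nnegrE ?mulr_ge0// ?(ltW L0) ?(ltW tau0)// real_normK ?num_real//.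
  rewrite (le_trans h)// exprMn; apply: ler_wpM2l; first exact: sqr_ge0.
  rewrite -real_normK ?num_real// ler_sqr ?nnegrE ?normr_ge0 ?(ltW tau0)//.
  by rewrite ler_norml.
have -> : central_diff tau (noisy f delta) x i =
   gradient f (x + t *: std_basis i) 0 i +
   (delta (x + tau *: std_basis i) - delta (x - tau *: std_basis i)) / (2 * tau).
  rewrite /central_diff /noisy opprD addrACA E opprK; field.
  by rewrite gt_eqF.
rewrite addrAC; apply: le_trans (ler_normD _ _) _; apply: lerD => //.
rewrite normrM normfV [`|2 * tau|]gtr0_norm ?mulr_gt0// ler_pdivrMr ?mulr_gt0//.
apply: le_trans (ler_normB _ _) _.
have -> : Delta / tau * (2 * tau) = Delta + Delta by field; rewrite gt_eqF.
by apply: lerD; [apply: d1|apply: d2]; rewrite lexx ?andbT ge0_cp// ltW.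
Qed.

End Smoothness.

(** * Finite sums under the integral *)

Section RintegralFinite.
Context {disp : measure_display} {T : measurableType disp} {R : realType}
  (mu : {finite_measure set T -> \bar R}).

Lemma integrable_sumR (I : Type) (r : seq I) (F : I -> T -> R) :
  (forall i, mu.-integrable setT (EFin \o F i)) ->
  mu.-integrable setT (EFin \o (fun w => \sum_(i <- r) F i w)).
Proof.
move=> iF; have -> : EFin \o (fun w => \sum_(i <- r) F i w) =
    (fun w => (\sum_(i <- r) (EFin \o F i) w)%E).
  by apply/funext => w /=; rewrite sumEFin.
exact: integrable_sum.
Qed.

Lemma Rintegral_sum (I : Type) (r : seq I) (F : I -> T -> R) :
  (forall i, mu.-integrable setT (EFin \o F i)) ->
  \int[mu]_w (\sum_(i <- r) F i w) = \sum_(i <- r) \int[mu]_w F i w.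
Proof.
move=> iF; elim: r => [|i r IH].
  under eq_Rintegral do rewrite big_nil.
  by rewrite big_nil Rintegral_cst// mul0r.
under eq_Rintegral do rewrite big_cons.
rewrite big_cons RintegralD// ?IH//; exact: integrable_sumR.
Qed.

Lemma Rintegral_indic (A : set T) : measurable A ->
  \int[mu]_w \1_A w = fine (mu A).
Proof. by move=> mA; rewrite /Rintegral integral_indic// setIT. Qed.

End RintegralFinite.

(** * Functions of finitely many sampled indices *)

Section History.
Context {R : realType} {d : nat} {disp : measure_display}
  {Omega : measurableType disp} (P : probability Omega R)
  (idx : nat -> Omega -> 'I_d).

(** The inequality is strict, so index [k] is still fresh given the history at [k]. *)
Definition same_history k (w w' : Omega) : Prop :=
  forall j, (j < k)%N -> idx j w = idx j w'.

(** Pointwise form of measurability with respect to the first [k] indices; the decomposition over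
    cylinders recovers measurability. *)
Definition adapted k (T : Type) (g : Omega -> T) : Prop :=
  forall w w', same_history k w w' -> g w = g w'.

Definition history k (w : Omega) : {ffun 'I_k -> 'I_d} := [ffun j => idx (val j) w].

Lemma adaptedS k T (g : Omega -> T) : adapted k g -> adapted k.+1 g.
Proof. by move=> ag w w' h; apply: ag => j jk; exact/h/ltnW. Qed.

Definition cylinder k (t : {ffun 'I_k -> 'I_d}) : set Omega :=
  [set w | history k w = t].

(** The singleton of [t j] when [j < k] and all of ['I_d] otherwise; the quantifier makes it total
    in [j]. *)
Definition cylinder_side k (t : {ffun 'I_k -> 'I_d}) (j : nat) : set 'I_d :=
  [set i | forall j' : 'I_k, j' = j :> nat -> i = t j'].

Lemma cylinderE k (t : {ffun 'I_k -> 'I_d}) :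
  cylinder t = \bigcap_(j in [set` iota 0 k]) (idx j @^-1` cylinder_side t j).
Proof.
apply/seteqP; split=> w.
  by move=> <- j _ /= j' <-; rewrite ffunE.
move=> h; apply/ffunP => j; rewrite ffunE.
by apply: (h (val j)) => //=; rewrite mem_iota /=.
Qed.

Hypothesis unif : uniform_indices P idx.
Hypothesis indep : independent_indices P idx.

Lemma measurable_cylinder k (t : {ffun 'I_k -> 'I_d}) : measurable (cylinder t).
Proof.
rewrite cylinderE; apply: fin_bigcap_measurable => // j /=.
rewrite mem_iota /= => jk.
rewrite (_ : cylinder_side t j = [set t (Ordinal jk)]); first exact: (unif _ _).1.
apply/seteqP; split=> i /=; first exact.
by move=> -> j' jj'; congr (t _); exact: val_inj.
Qed.

(** Fixing index [k] as well gives a rectangle over [k.+1] indices, and independence factors both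
    rectangles. *)
Lemma cylinder_indep k (t : {ffun 'I_k -> 'I_d}) j :
  P (cylinder t `&` idx k @^-1` [set j]) = (P (cylinder t) * (d%:R^-1)%:E)%E.
Proof.
pose A m := if m == k then [set j] else cylinder_side t m.
have Alt m : m \in iota 0 k -> A m = cylinder_side t m.
  by rewrite mem_iota /= /A => mk; rewrite ltn_eqF.
have iotaE n m : [set` iota 0 n] m = (m < n)%N :> Prop.
  by rewrite /mkset mem_iota.
have -> : cylinder t `&` idx k @^-1` [set j] =
    \bigcap_(m in [set` iota 0 k.+1]) (idx m @^-1` A m).
  rewrite cylinderE; apply/seteqP; split=> w.
    move=> [h kj] m; rewrite iotaE ltnS leq_eqVlt /A.
    by case: (eqVneq m k) => [->//|_ /= mk]; apply: h; rewrite iotaE.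
  move=> h; split=> [m mk|].
    by rewrite -(Alt m mk); apply: h; move: mk; rewrite !iotaE; exact: ltnW.
  by have := h k; rewrite iotaE ltnS leqnn /A eqxx; exact.
rewrite indep ?iota_uniq// -addn1 iotaD big_cat /= big_seq1 add0n.
rewrite {2}/A eqxx (unif k j).2 cylinderE indep ?iota_uniq//; congr (_ * _)%E.
by apply: eq_big_seq => m /Alt ->.
Qed.

(** An adapted function is constant on each of the finitely many cylinders, and these partition
    [Omega]. *)
Lemma adapted_simple k (g : Omega -> R) : adapted k g ->
  exists c : {ffun 'I_k -> 'I_d} -> R,
    g = fun w => \sum_(t : {ffun 'I_k -> 'I_d}) c t * \1_(cylinder t) w.
Proof.
move=> ag.
(* The coefficient is the value at a chosen point of the cylinder; an empty cylinder gets the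
   default 0, which is harmless because its indicator vanishes. *)
exists (fun t => if pselect (exists w, cylinder t w) is left e
                 then g (projT1 (cid e)) else 0).
apply/funext => w; rewrite (bigD1 (history k w))//= big1 ?addr0 => [|t tw].
  rewrite indicE mem_set// mulr1; case: pselect => [e|[]]; last by exists w.
  apply: ag => j jk; case: (cid e) => w' /= /ffunP /(_ (Ordinal jk)).
  by rewrite !ffunE.
rewrite indicE memNset ?mulr0// => /= wt.
by move: tw; rewrite -wt eqxx.
Qed.

Lemma adapted_integrable k (g : Omega -> R) : adapted k g ->
  P.-integrable setT (EFin \o g).
Proof.
move=> /adapted_simple[c ->]; apply: integrable_sumR => t.
apply: (@integrableZl _ _ _ P _ measurableT (c t)
  (EFin \o (\1_(cylinder t) : Omega -> R))).
exact/integrable_indic/measurable_cylinder.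
Qed.

Lemma adapted_indep k (g : Omega -> R) (j : 'I_d) : adapted k g ->
  \int[P]_w ((idx k w == j)%:R * g w) = d%:R^-1 * \int[P]_w g w.
Proof.
move=> /adapted_simple[c ->].
have mI : measurable (idx k @^-1` [set j]) by exact: (unif _ _).1.
have i1 (t : {ffun 'I_k -> 'I_d}) :
    P.-integrable setT (EFin \o (\1_(cylinder t) : Omega -> R)).
  exact/integrable_indic/measurable_cylinder.
have i2 (t : {ffun 'I_k -> 'I_d}) : P.-integrable setT
    (EFin \o (\1_(cylinder t `&` idx k @^-1` [set j]) : Omega -> R)).
  by apply/integrable_indic/measurableI => //; exact: measurable_cylinder.
have -> : (fun w => (idx k w == j)%:R *
      (\sum_(t : {ffun 'I_k -> 'I_d}) c t * \1_(cylinder t) w)) =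
    (fun w => \sum_(t : {ffun 'I_k -> 'I_d})
       c t * \1_(cylinder t `&` idx k @^-1` [set j]) w).
  apply/funext => w; rewrite mulr_sumr; apply: eq_bigr => t _.
  rewrite mulrCA; congr (_ * _); rewrite !indicE in_setI mulrC -natrM mulnb.
  by congr ((_ && _)%:R); apply/eqP/idP; rewrite inE.
rewrite !Rintegral_sum => [|t|t]; first last.
- exact: (@integrableZl _ _ _ P _ measurableT (c t) (EFin \o _)).
- exact: (@integrableZl _ _ _ P _ measurableT (c t) (EFin \o _)).
rewrite mulr_sumr; apply: eq_bigr => t _.
have mC := measurable_cylinder t.
rewrite !RintegralZl// !Rintegral_indic//; last exact: measurableI.
rewrite [RHS]mulrCA; congr (_ * _).
rewrite -[d%:R^-1]/(fine (d%:R^-1)%:E) -fineM ?fin_num_measure// muleC.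
exact/congr1/cylinder_indep.
Qed.

Lemma adapted_sampled k (u : 'I_d -> Omega -> R) :
  (forall j, adapted k (u j)) -> adapted k.+1 (fun w => u (idx k w) w).
Proof.
by move=> au w w' h; rewrite (h k (ltnSn k)); exact/(adaptedS (au _)).
Qed.

(** Plays the part of conditioning on the past: split according to the value of the fresh index,
    then apply independence to each term. *)
Lemma mean_sampled k (u : 'I_d -> Omega -> R) : (forall j, adapted k (u j)) ->
  \int[P]_w u (idx k w) w = d%:R^-1 * \int[P]_w (\sum_j u j w).
Proof.
move=> au.
have -> : (fun w => u (idx k w) w) =
    (fun w => \sum_(j < d) (idx k w == j)%:R * u j w).
  apply/funext => w; rewrite (bigD1 (idx k w))//= eqxx mul1r big1 ?addr0// => j.
  by rewrite eq_sym => /negPf ->; rewrite mul0r.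
rewrite !Rintegral_sum => [|j|j]; first last.
- apply: (@adapted_integrable k.+1) => w w' h; rewrite (h k (ltnSn k)).
  by congr (_ * _); exact: (adaptedS (au j)).
- exact: adapted_integrable (au j).
by rewrite mulr_sumr; apply: eq_bigr => j _; exact: adapted_indep.
Qed.

End History.

(** * Scalar recursions for the variance and for the gap *)

(* [n] is the dimension, [G = k + 8 n] is four times the inverse step size,
   [X = L D], [eps] the error of one central difference, and [v], [w], [phi]
   are the means of |h^k - grad f(x^k)|^2, |h^(k+1) - grad f(x^k)|^2 and
   f(x^k) - f^*. *)
Section Recursions.
Context {R : realType}.
Implicit Types n G : R.

(** The loss in passing from step [k] to [k.+1]. Since [8 * n <= G], one has [4 * n * (2 * G + 1) <=
    G ^+ 2 + G / 2 <= (G + 1) ^+ 2]. *)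
Lemma inv_sqrS_ge n G : 1 <= n -> 8 * n <= G ->
  (1 - (4 * n)^-1) / G ^+ 2 <= ((G + 1) ^+ 2)^-1.
Proof.
move=> n1 nG; have G0 : 0 < G by lra.
rewrite ler_pdivrMr ?exprn_gt0// [leRHS]mulrC ler_pdivlMr ?exprn_gt0//; last by lra.
have n0 : 4 * n != 0 by rewrite gt_eqF//; lra.
rewrite -subr_ge0.
have -> : G ^+ 2 - (1 - (4 * n)^-1) * (G + 1) ^+ 2 =
  ((G + 1) ^+ 2 - 4 * n * (2 * G + 1)) / (4 * n) by field; lra.
apply: divr_ge0; last by lra.
nra.
Qed.

(** The contraction [(1 + 1/(2n)) (1 - 1/n) <= 1 - 1/(2n)] frees [128 n X^2 / G^2]; the drift takes
    at most [48 n X^2 / G^2] of it and the passage to [G + 1] takes [64 n X^2 / G^2]. *)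
Lemma variance_recursion n G X eps v w v' : 1 <= n -> 8 * n <= G ->
  v <= 256 * n ^+ 2 * X ^+ 2 / G ^+ 2 + 3 * n * eps ^+ 2 ->
  w <= eps ^+ 2 + (1 - n^-1) * v ->
  v' <= (1 + (2 * n)^-1) * w + (1 + 2 * n) * (X ^+ 2 * (4 / G) ^+ 2) ->
  v' <= 256 * n ^+ 2 * X ^+ 2 / (G + 1) ^+ 2 + 3 * n * eps ^+ 2.
Proof.
move=> n1 nG hv hw hv'; have n0 : 0 < n by lra.
have G0 : 0 < G by lra.
have p0 : 0 < n^-1 by rewrite invr_gt0.
have p1 : n^-1 <= 1 by rewrite invf_le1.
have pn : n * n^-1 = 1 by rewrite divff// gt_eqF.
have hS := inv_sqrS_ge n1 nG.
set q := (G ^+ 2)^-1 in hv hS; set q' := ((G + 1) ^+ 2)^-1 in hS *.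
have q0 : 0 < q by rewrite invr_gt0 exprn_gt0.
have E4 : (4 / G) ^+ 2 = 16 * q by rewrite exprMn exprVn /q; congr (_ * _); ring.
rewrite E4 in hv'.
set p := n^-1 in hw p0 p1 pn.
have Ei (a : R) : 0 < a -> (a * n)^-1 = a^-1 * p by move=> ?; rewrite invfM.
rewrite !Ei // in hS hv'.
set Y := X ^+ 2 in hv hv' *; have Y0 : 0 <= Y by exact: sqr_ge0.
set Z := eps ^+ 2 in hv hw *; have Z0 : 0 <= Z by exact: sqr_ge0.
have h1 : (1 + 2^-1 * p) * w <=
    (1 + 2^-1 * p) * (Z + (1 - p) * (256 * n ^+ 2 * Y * q + 3 * n * Z)).
  apply: ler_wpM2l; first by lra.
  by apply: le_trans hw _; rewrite lerD2l ler_wpM2l// subr_ge0.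
apply: (le_trans hv'); apply: (le_trans (lerD h1 (lexx _))).
have h2 : 256 * n ^+ 2 * Y * ((1 - 4^-1 * p) * q) <= 256 * n ^+ 2 * Y * q'.
  exact: ler_wpM2l (mulr_ge0 (mulr_ge0 (ler0n _ _) (sqr_ge0 _)) Y0) _ _ hS.
apply: le_trans (lerD h2 (lexx _)).
have Yq : 0 <= Y * q by rewrite mulr_ge0// ltW.
have -> : 256 * n ^+ 2 * Y * ((1 - 4^-1 * p) * q) + 3 * n * Z =
  (Y * q) * (256 * n ^+ 2 - 64 * n * (n * p)) + 3 * n * Z by field.
(* Once [n * p = 1], the coefficient of [Y * q] is [256 n^2 - 96 n - 112] against [256 n^2 - 64 n],
   and that of [Z] is [3 n - 1/2 - p] against [3 n]. *)
have -> : (1 + 2^-1 * p) * (Z + (1 - p) * (256 * n ^+ 2 * Y * q + 3 * n * Z)) +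
   (1 + 2 * n) * (Y * (16 * q)) =
  (Y * q) * (256 * n ^+ 2 - 128 * n * (n * p) - 128 * (n * p) ^+ 2 +
     16 * (1 + 2 * n))
  + Z * (1 + 2^-1 * p + 3 * n - 3 / 2 * (n * p) - 3 / 2 * (n * p) * p) by field.
rewrite pn; apply: lerD; last by rewrite [3 * n * Z]mulrC; apply: ler_wpM2l => //; lra.
by apply: ler_wpM2l => //; lra.
Qed.

(** Provides an explicit root for the mean squared error: [eps^2 + 3 n eps^2 <= 4 n eps^2], and the
    cross term of the completed square is nonnegative. *)
Lemma estimator_bound n G X eps v w : 1 <= n -> 0 < G -> 0 <= X -> 0 <= eps ->
  v <= 256 * n ^+ 2 * X ^+ 2 / G ^+ 2 + 3 * n * eps ^+ 2 ->
  w <= eps ^+ 2 + (1 - n^-1) * v ->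
  w <= (16 * n * X / G + 2 * Num.sqrt n * eps) ^+ 2.
Proof.
move=> n1 G0 X0 eps0 hv hw; have n0 : 0 < n by lra.
have p0 : 0 < n^-1 by rewrite invr_gt0.
have p1 : n^-1 <= 1 by rewrite invf_le1.
set b := 256 * n ^+ 2 * X ^+ 2 / G ^+ 2 + 3 * n * eps ^+ 2 in hv.
have b0 : 0 <= b.
  apply: addr_ge0 (divr_ge0 (mulr_ge0 _ (sqr_ge0 _)) (sqr_ge0 _))
    (mulr_ge0 _ (sqr_ge0 _)).
    exact: mulr_ge0 (ler0n _ _) (sqr_ge0 _).
  by rewrite mulr_ge0// ltW.
have : w <= eps ^+ 2 + b.
  apply: le_trans hw _; rewrite lerD2l.
  apply: (@le_trans _ _ ((1 - n^-1) * b)); first by apply: ler_wpM2l => //; lra.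
  by rewrite ler_piMl//; lra.
move/le_trans; apply.
rewrite sqrrD [(2 * _ * _) ^+ 2]exprMn [(2 * _) ^+ 2]exprMn sqr_sqrtr; last by lra.
have -> : (16 * n * X / G) ^+ 2 = 256 * n ^+ 2 * X ^+ 2 / G ^+ 2.
  by field; rewrite gt_eqF.
have : 0 <= 16 * n * X / G * (2 * Num.sqrt n * eps) *+ 2.
  rewrite mulrn_wge0// mulr_ge0//; last by rewrite mulr_ge0// mulr_ge0// sqrtr_ge0.
  by rewrite divr_ge0// ?mulr_ge0// ltW.
have : eps ^+ 2 <= n * eps ^+ 2 by rewrite ler_peMl ?sqr_ge0.
rewrite /b; lra.
Qed.

(** As [w <= B ^+ 2], the Young term is at most [D * B]. Its [eps] part restores exactly what the
    contraction removes from [2 * s * eps * D]. At order [G^-2] the contraction gains 128 copies of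
    [n * M] and the passage to [G + 1] costs 32; the remaining 96 cover 64 copies of
    [n * (L * D ^+ 2)] and 16 of [L * D ^+ 2]. *)
Lemma gap_recursion n G L D M s eps B phi w phi' : 1 <= n -> 8 * n <= G ->
  0 < D -> L * D ^+ 2 <= M -> 0 <= M ->
  B = 16 * n * (L * D) / G + 2 * s * eps -> 0 < B ->
  phi <= 32 * n * M / G + 2 * s * eps * D ->
  w <= B ^+ 2 ->
  phi' <= (1 - 4 / G) * phi + 4 / G * (D * (w / (2 * B) + B / 2)) +
            L * (4 / G) ^+ 2 * D ^+ 2 ->
  phi' <= 32 * n * M / (G + 1) + 2 * s * eps * D.
Proof.
move=> n1 nG D0 LM M0 EB B0 hphi hw hphi'.
have G0 : 0 < G by lra.
have q0 : 0 < G^-1 by rewrite invr_gt0.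
have q1 : 4 / G <= 1 by rewrite ler_pdivrMr//; lra.
have hB : D * (w / (2 * B) + B / 2) <= D * B.
  apply: ler_wpM2l; first exact: ltW.
  have : w / (2 * B) <= B / 2.
    rewrite ler_pdivrMr ?mulr_gt0//; apply: le_trans hw _.
    by rewrite le_eqVlt; apply/orP; left; apply/eqP; field.
  lra.
apply: (le_trans hphi').
have h1 : (1 - 4 / G) * phi <= (1 - 4 / G) * (32 * n * M / G + 2 * s * eps * D).
  by apply: ler_wpM2l => //; lra.
have h2 : 4 / G * (D * (w / (2 * B) + B / 2)) <= 4 / G * (D * B).
  by apply: ler_wpM2l => //; apply: ltW; rewrite divr_gt0.
apply: (le_trans (lerD (lerD h1 h2) (lexx _))).
have h3 : n * (L * D ^+ 2) <= n * M by apply: ler_wpM2l => //; lra.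
have hG : G / (G + 1) >= 1 - G^-1.
  rewrite ler_pdivlMr; last by lra.
  have -> : (1 - G^-1) * (G + 1) = G - G^-1 by field; rewrite gt_eqF.
  lra.
have -> : 32 * n * M / (G + 1) = 32 * n * M / G * (G / (G + 1)).
  by field; rewrite !gt_eqF//; lra.
have h4 : 32 * n * M / G * (1 - G^-1) <= 32 * n * M / G * (G / (G + 1)).
  by apply: ler_wpM2l => //; rewrite divr_ge0 ?mulr_ge0//; lra.
apply: le_trans (lerD h4 (lexx _)); rewrite EB -subr_ge0.
set r := G^-1 in q0 *; set K := 2 * s * eps.
have -> : 32 * n * M * r * (1 - r) + K * D -
  ((1 - 4 * r) * (32 * n * M * r + K * D) +
   4 * r * (D * (16 * n * (L * D) * r + K)) + L * (4 * r) ^+ 2 * D ^+ 2) =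
  r ^+ 2 * (96 * (n * M) - 64 * (n * (L * D ^+ 2)) - 16 * (L * D ^+ 2)) by ring.
apply: mulr_ge0; first exact: sqr_ge0.
have : M <= n * M by rewrite ler_peMl.
lra.
Qed.

End Recursions.

(** * Deterministic inequalities for one step of the algorithm *)

Section PathwiseBounds.
Context {R : realType} {d : nat}.
Implicit Types (f delta g : 'rV[R]_d -> R) (x h s v y z : 'rV[R]_d).
Implicit Types (Q : set 'rV[R]_d) (eps : R).

Lemma convex_segment Q y z (t : R) : convex_set Q -> Q y -> Q z ->
  0 <= t <= 1 -> Q (y + t *: (z - y)).
Proof.
move=> cQ Qy Qz /andP[t0 t1].
have := cQ z y (Itv01 t0 t1) (mem_set Qz) (mem_set Qy); rewrite inE.
congr (Q _); rewrite /conv /= /unstable.onem scalerBr scalerBl scale1r.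
by rewrite addrCA.
Qed.

Lemma full_approxE (tau : R) g x j : full_approx tau g x 0 j = central_diff tau g x j.
Proof.
rewrite summxE (bigD1 j)//= big1 ?addr0 => [|i ij].
  by rewrite mxE basisE eqxx mulr1.
by rewrite mxE basisE eq_sym (negPf ij) mulr0.
Qed.

Lemma jaguar_updateE (tau : R) g x h i j :
  jaguar_update tau g x h i 0 j = if j == i then central_diff tau g x i else h 0 j.
Proof.
rewrite !mxE dotp_basisr eqxx /=; case: eqVneq => [->|_].
  by rewrite !mulr1 subrr add0r.
by rewrite !mulr0 subr0 addr0.
Qed.

Lemma full_approx_error (tau : R) g x v eps :
  (forall i, `|central_diff tau g x i - v 0 i| <= eps) ->
  dotp (full_approx tau g x - v) (full_approx tau g x - v) <= d%:R * eps ^+ 2.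
Proof.
move=> he; rewrite [leRHS](_ : _ = \sum_(i < d) eps ^+ 2); last first.
  by rewrite sumr_const card_ord mulr_natl.
apply: ler_sum => i _; rewrite !mxE full_approxE -expr2.
rewrite -real_normK ?num_real// ler_sqr ?nnegrE//.
exact: le_trans (normr_ge0 _) (he i).
Qed.

(** The refreshed coordinate costs at most [eps ^+ 2] and the others keep their error. The old error
    of coordinate [i] stays explicit because its mean over a uniform [i] is the fraction [1/d] of
    the total. *)
Lemma jaguar_update_error (tau : R) g x h v eps i :
  `|central_diff tau g x i - v 0 i| <= eps ->
  dotp (jaguar_update tau g x h i - v) (jaguar_update tau g x h i - v) <=
  eps ^+ 2 + (dotp (h - v) (h - v) - (h - v) 0 i ^+ 2).
Proof.
move=> he; rewrite /dotp (bigD1 i)//= [X in _ + (X - _)](bigD1 i)//=.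
rewrite -!expr2 [X in _ <= _ + X]addrAC subrr add0r; apply: lerD.
  rewrite mxE jaguar_updateE eqxx mxE.
  rewrite -real_normK ?num_real// ler_sqr ?nnegrE//.
  exact: le_trans (normr_ge0 _) he.
apply: ler_sum => j /negPf ji.
by rewrite mxE jaguar_updateE ji !mxE.
Qed.

(* Young's inequality with weight [B / D] makes the estimation error enter
   through its square, whose mean is controlled; for a mean of at most [B ^+ 2]
   the resulting term is at most [D * B]. *)
Lemma frank_wolfe_step Q f (L D B gam : R) x h s :
  convex_set Q -> (forall y z, Q y -> Q z -> enorm (y - z) <= D) ->
  (forall y, Q y -> differentiable f y) ->
  0 < L -> lipschitz_gradient_on Q f L -> convex_on Q f ->
  0 < D -> 0 < B -> 0 < gam <= 1 ->
  Q x -> argmin_on Q (fun y => dotp y h) s ->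
  f (x + gam *: (s - x)) - min_on Q f <=
  (1 - gam) * (f x - min_on Q f) +
  gam * (D * (dotp (h - gradient f x) (h - gradient f x) / (2 * B) + B / 2)) +
  L * gam ^+ 2 * D ^+ 2.
Proof.
move=> cQ diamQ df L0 lip cf D0 B0 /andP[gam0 gam1] Qx [Qs smin].
have n2 y z : Q y -> Q z -> dotp (y - z) (y - z) <= D ^+ 2.
  by move=> Qy Qz; exact/enorm_le_sqr/diamQ.
set E := dotp (h - _) _.
(* Proved for every competitor [y] in [Q], so that the infimum can be taken at the end. *)
have step y : Q y -> f (x + gam *: (s - x)) <= f x + gam * (f y - f x) +
    gam * (D * (E / (2 * B) + B / 2)) + L * gam ^+ 2 * D ^+ 2.
  move=> Qy.
  have seg t : 0 <= t <= 1 -> Q (x + t *: (gam *: (s - x))).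
    move=> /andP[t0 t1]; rewrite scalerA; apply: convex_segment => //.
    by rewrite mulr_ge0 ?(ltW gam0)// mulr_ile1// ltW.
  have := descent_lemma L0 lip df seg.
  rewrite !dotpZr dotpZl => /le_trans; apply.
  rewrite -addrA -[leRHS]addrA -[leRHS]addrA lerD2l [leRHS]addrA -mulrDr.
  apply: lerD; last first.
    rewrite -[leRHS]mulrA ler_wpM2l ?(ltW L0)// mulrA -expr2.
    by rewrite ler_wpM2l ?sqr_ge0// n2.
  rewrite ler_wpM2l ?(ltW gam0)//.
  have ym := @young_dotp _ _ (B / D) (h - gradient f x) (y - s) (divr_gt0 B0 D0).
  have : dotp (h - gradient f x) (y - s) <= D * (E / (2 * B) + B / 2).
    apply: le_trans ym _.
    have -> : D * (E / (2 * B) + B / 2) =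
        E / (2 * (B / D)) + B / D * D ^+ 2 / 2 by field; rewrite !gt_eqF.
    rewrite lerD2l ler_pM2r ?invr_gt0// ler_wpM2l ?n2//.
    by rewrite divr_ge0 ?ltW.
  (* With [v] the gradient at [x]: [<v, s - x> = <v, y - x> + <h, s - y> + <h - v, y - s>].
     Convexity bounds the first term by [f y - f x], the choice of [s] makes the second nonpositive,
     and Young's inequality bounds the third. *)
  have := smin y Qy; have := cf x y Qx Qy; rewrite !dotpE (dotpC y h) (dotpC s h); lra.
(* [step] solved for [f y]: the left side is a lower bound of [f] on [Q]. *)
have : gam^-1 * (f (x + gam *: (s - x)) - (1 - gam) * f x -
    gam * (D * (E / (2 * B) + B / 2)) - L * gam ^+ 2 * D ^+ 2) <= min_on Q f.
  apply: lb_le_inf; first by exists (f x), x.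
  move=> _ [y Qy <-]; rewrite mulrC ler_pdivrMr//.
  have := step y Qy; lra.
by rewrite mulrC ler_pdivrMr//; lra.
Qed.

(** The estimator is fixed while the gradient moves with the iterate. The weight [a] will be
    [2 * n], so that the factor [1 + 1/(2n)] leaves part of the contraction [1 - 1/n] intact. *)
Lemma tracking_error Q f (L D gam a : R) x s h :
  convex_set Q -> (forall y z, Q y -> Q z -> enorm (y - z) <= D) ->
  lipschitz_gradient_on Q f L -> 0 <= gam <= 1 -> 0 < a -> Q x -> Q s ->
  dotp (h - gradient f (x + gam *: (s - x))) (h - gradient f (x + gam *: (s - x)))
  <= (1 + a^-1) * dotp (h - gradient f x) (h - gradient f x) +
     (1 + a) * ((L * D) ^+ 2 * gam ^+ 2).
Proof.
move=> cQ diamQ lip gam01 a0 Qx Qs; set y := x + _.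
have Qy : Q y by exact: convex_segment.
have -> : h - gradient f y = (h - gradient f x) + (gradient f x - gradient f y).
  by rewrite addrA subrK.
apply: le_trans (young_dotpD _ _ a0) _; rewrite lerD2l ler_wpM2l//.
  by rewrite ltW// addr_gt0.
apply: le_trans (lipschitz_gradient_sqr lip Qx Qy) _.
rewrite exprMn -[leRHS]mulrA ler_wpM2l ?sqr_ge0// /y opprD addrA subrr sub0r.
rewrite dotpNl dotpNr opprK dotpZl dotpZr mulrA -expr2 mulrC ler_wpM2r ?sqr_ge0//.
exact/enorm_le_sqr/diamQ.
Qed.

End PathwiseBounds.

(** * Expectations along a run of the algorithm *)

Section Run.
Context {R : realType} {d : nat} {Q : set 'rV[R]_d} {f delta : 'rV[R]_d -> R}
  {D L Delta tau : R} {x0 : 'rV[R]_d} {disp : measure_display}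
  {Omega : measurableType disp} {P : probability Omega R}
  {idx : nat -> Omega -> 'I_d} {x h s : nat -> Omega -> 'rV[R]_d}.
Hypothesis d0 : (0 < d)%N.
Hypothesis tau0 : 0 < tau.
Hypothesis cQ : convex_set Q.
Hypothesis D0 : 0 < D.
Hypothesis diamQ : forall y z, Q y -> Q z -> enorm (y - z) <= D.
Hypothesis df : forall y, stencil_nbhd tau Q y -> differentiable f y.
Hypothesis L0 : 0 < L.
Hypothesis lip : lipschitz_gradient_on (stencil_nbhd tau Q) f L.
Hypothesis cf : convex_on Q f.
Hypothesis Delta0 : 0 < Delta.
Hypothesis hdelta :
  forall y, stencil_nbhd tau Q y -> `|delta y| ^+ 2 <= Delta ^+ 2.
Hypothesis Qx0 : Q x0.
Hypothesis unif : uniform_indices P idx.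
Hypothesis indep : independent_indices P idx.

Let n : R := d%:R.
Let G k : R := k%:R + 8 * d%:R.
Let gam k : R := 4 / G k.
Let eps := L * tau + Delta / tau.
Let g := noisy f delta.

Hypothesis run : fw_jaguar Q tau g gam x0 idx x h s.

Let fstar := min_on Q f.
Let M := Num.max (L * D ^+ 2) (f x0 - fstar).
Let V k w := dotp (h k w - gradient f (x k w)) (h k w - gradient f (x k w)).
Let W k w := dotp (h k.+1 w - gradient f (x k w)) (h k.+1 w - gradient f (x k w)).
Let B k := 16 * n * (L * D) / G k + 2 * Num.sqrt n * eps.

Let n1 : 1 <= n.
Proof. by rewrite /n ler1n. Qed.

Let Gn k : 8 * n <= G k.
Proof. by rewrite /G lerDr. Qed.

Let G0 k : 0 < G k.
Proof. by apply: lt_le_trans (Gn k); have := n1; lra. Qed.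

Let GS k : G k.+1 = G k + 1.
Proof. by rewrite /G -natr1 addrAC. Qed.

Let gam01 k : 0 < gam k <= 1.
Proof.
have := Gn k; have := n1 => ? ?.
by rewrite divr_gt0//= ler_pdivrMr// mul1r; lra.
Qed.

Let eps0 : 0 < eps.
Proof. by rewrite addr_gt0 ?divr_gt0 ?mulr_gt0. Qed.

Let B0 k : 0 < B k.
Proof.
have nn : 0 < n by have := n1; lra.
by rewrite addr_gt0// ?divr_gt0 ?mulr_gt0// sqrtr_gt0.
Qed.

Let sub_stencil y : Q y -> stencil_nbhd tau Q y.
Proof.
(* Zero displacement along a coordinate, which exists because [0 < d]. *)
by move=> Qy; exists y, (Ordinal d0), 0; rewrite normr0 scale0r addr0 ltW.
Qed.

Let lipQ : lipschitz_gradient_on Q f L.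
Proof. by move=> y z Qy Qz; apply: lip; exact: sub_stencil. Qed.

Lemma run_in_Q k w : Q (x k w).
Proof.
have [h0 _ hs _ hx] := run; elim: k => [|k IH]; first by rewrite (h0 w).1.
rewrite hx; apply: convex_segment => //; first by case: (hs k w).
by case/andP: (gam01 k) => /ltW -> ->.
Qed.

(** [s k] may use index [k], and so may [x k.+1] and [h k.+1]; hence only indices below [k] enter
    [x k] and [h k]. *)
Lemma run_adapted k : adapted idx k (x k) /\ adapted idx k (h k).
Proof.
have [h0 hh _ hs hx] := run; elim: k => [|k [IHx IHh]].
  by split=> w w' _; rewrite ?(h0 w).1 ?(h0 w).2 ?(h0 w').1 ?(h0 w').2.
have IHx' := adaptedS IHx; have IHh' := adaptedS IHh.
split=> w w' ww'.
  by rewrite !hx (IHx' w w' ww') (hs k w w' ww').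
by rewrite !hh (IHx' w w' ww') (IHh' w w' ww') (ww' k (ltnSn k)).
Qed.

Let xA k : adapted idx k (x k). Proof. exact: (run_adapted k).1. Qed.
Let hA k : adapted idx k (h k). Proof. exact: (run_adapted k).2. Qed.

Let VA k : adapted idx k (V k).
Proof. by move=> w w' ww'; rewrite /V (xA ww') (hA ww'). Qed.

Let WA k : adapted idx k.+1 (W k).
Proof. by move=> w w' ww'; rewrite /W (adaptedS (@xA k) ww') (hA ww'). Qed.

Let FA k : adapted idx k (fun w => f (x k w) - fstar).
Proof. by move=> w w' ww'; rewrite (xA ww'). Qed.

Let integ k (u : Omega -> R) : adapted idx k u -> P.-integrable setT (EFin \o u).
Proof. exact: adapted_integrable. Qed.

Let int_cst (c : R) : P.-integrable setT (EFin \o (fun=> c)).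
Proof. exact: finite_measure_integrable_cst. Qed.

Let mean_cst (c : R) : \int[P]_w c = c.
Proof. by rewrite Rintegral_cst// [X in fine X](@probability_setT _ _ _ P) mulr1. Qed.

Let cd_error y i : Q y -> `|central_diff tau g y i - gradient f y 0 i| <= eps.
Proof. by move=> Qy; exact: (central_diff_error i tau0 L0 lip df Delta0 hdelta Qy). Qed.

(** The error [u j] of a coordinate depends on the past alone, so at the sampled coordinate its mean
    is [1/n] times the mean of [V k]; subtracting it gives the contraction. *)
Lemma mean_variance_update k :
  \int[P]_w W k w <= eps ^+ 2 + (1 - n^-1) * \int[P]_w V k w.
Proof.
pose u j w := (h k w - gradient f (x k w)) 0 j ^+ 2.
have uA j : adapted idx k (u j) by move=> w w' ww'; rewrite /u (xA ww') (hA ww').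
have VE : (fun w => \sum_j u j w) = V k.
  by apply/funext => w; apply: eq_bigr => j _; rewrite /u expr2.
have sA := adapted_sampled uA.
have <- : \int[P]_w (eps ^+ 2 + (V k w - u (idx k w) w)) =
    eps ^+ 2 + (1 - n^-1) * \int[P]_w V k w.
  rewrite RintegralD//; last first.
    apply: (integ (k := k.+1)) => w w' ww'.
    by rewrite (sA w w' ww') (adaptedS (@VA k) ww').
  rewrite mean_cst RintegralB//; last 2 first.
  - exact: integ (@VA k).
  - exact: integ sA.
  by rewrite (mean_sampled unif indep uA) VE mulrBl mul1r.
apply: (le_Rintegral measurableT).
- exact: integ (@WA k).
- apply: (integ (k := k.+1)) => w w' ww'.
  by rewrite (sA w w' ww') (adaptedS (@VA k) ww').
- move=> w _; rewrite /W /V /u; have [_ hh _ _ _] := run; rewrite hh.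
  by apply: jaguar_update_error; apply: cd_error; exact: run_in_Q.
Qed.

Lemma mean_variance_drift k :
  \int[P]_w V k.+1 w <=
  (1 + (2 * n)^-1) * \int[P]_w W k w + (1 + 2 * n) * ((L * D) ^+ 2 * (4 / G k) ^+ 2).
Proof.
have iW := integ (@WA k).
have <- : \int[P]_w ((1 + (2 * n)^-1) * W k w +
    (1 + 2 * n) * ((L * D) ^+ 2 * (4 / G k) ^+ 2)) =
  (1 + (2 * n)^-1) * \int[P]_w W k w + (1 + 2 * n) * ((L * D) ^+ 2 * (4 / G k) ^+ 2).
  rewrite RintegralD//; last first.
    by apply: (integ (k := k.+1)) => w w' ww'; rewrite (WA ww').
  by rewrite mean_cst RintegralZl.
apply: (le_Rintegral measurableT).
- exact: integ (@VA k.+1).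
- by apply: (integ (k := k.+1)) => w w' ww'; rewrite (WA ww').
- move=> w _; have [_ _ hs _ hx] := run; rewrite /V /W hx.
  have a0 : 0 < 2 * n by have := n1; lra.
  have gm : 0 <= gam k <= 1 by have /andP[/ltW ? ?] := gam01 k; apply/andP.
  have Qs : Q (s k w) by case: (hs k w).
  exact: (tracking_error (h k.+1 w) cQ diamQ lipQ gm a0 (run_in_Q k w) Qs).
Qed.

Lemma mean_variance_bound k : \int[P]_w V k w <=
  256 * n ^+ 2 * (L * D) ^+ 2 / G k ^+ 2 + 3 * n * eps ^+ 2.
Proof.
elim: k => [|k IH]; last first.
  rewrite GS; apply: (variance_recursion n1 (Gn k) IH (mean_variance_update k)).
  exact: mean_variance_drift.
have [h0 _ _ _ _] := run.
(* All coordinates of the initial estimator are central differences at [x0], so the initial error is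
   at most [n * eps ^+ 2]. *)
apply: (@le_trans _ _ (n * eps ^+ 2)); last first.
  have nn : 0 <= n by have := n1; lra.
  have : 0 <= 256 * n ^+ 2 * (L * D) ^+ 2 / G 0 ^+ 2.
    exact: divr_ge0 (mulr_ge0 (mulr_ge0 (ler0n _ _) (sqr_ge0 _)) (sqr_ge0 _)) (sqr_ge0 _).
  have := mulr_ge0 nn (sqr_ge0 eps).
  lra.
rewrite -[leRHS]mean_cst; apply: (le_Rintegral measurableT).
- exact: integ (@VA 0%N).
- exact: int_cst.
- move=> w _; rewrite /V (h0 w).1 (h0 w).2; apply: full_approx_error => i.
  exact: cd_error.
Qed.

Lemma mean_estimator_bound k : \int[P]_w W k w <= B k ^+ 2.
Proof.
apply: (estimator_bound n1 (G0 k) _ _ (mean_variance_bound k)).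
- by rewrite mulr_ge0// ltW.
- exact: ltW.
- exact: mean_variance_update.
Qed.

(** [B k] is deterministic, so the pathwise bound is affine in the squared error [W k] and the
    expectation passes through by linearity; no root of a random variable has to be averaged. *)
Lemma mean_gap_step k :
  \int[P]_w (f (x k.+1 w) - fstar) <=
  (1 - 4 / G k) * \int[P]_w (f (x k w) - fstar) +
  4 / G k * (D * (\int[P]_w W k w / (2 * B k) + B k / 2)) +
  L * (4 / G k) ^+ 2 * D ^+ 2.
Proof.
set c1 := 1 - 4 / G k; set c2 := 4 / G k * (D / (2 * B k)).
set c3 := 4 / G k * (D * (B k / 2)) + L * (4 / G k) ^+ 2 * D ^+ 2.
have FA' := adaptedS (@FA k).
have iF := integ FA'; have iW := integ (@WA k).
have iF1 : P.-integrable setT (EFin \o (fun w => c1 * (f (x k w) - fstar))).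
  by apply: (integ (k := k.+1)) => w w' ww'; rewrite (FA' w w' ww').
have iW1 : P.-integrable setT (EFin \o (fun w => c2 * W k w)).
  by apply: (integ (k := k.+1)) => w w' ww'; rewrite (WA ww').
have iFW : P.-integrable setT
    (EFin \o (fun w => c1 * (f (x k w) - fstar) + c2 * W k w)).
  apply: (integ (k := k.+1)) => w w' ww'.
  by rewrite (FA' w w' ww') (WA ww').
have -> : c1 * \int[P]_w (f (x k w) - fstar) +
    4 / G k * (D * (\int[P]_w W k w / (2 * B k) + B k / 2)) +
    L * (4 / G k) ^+ 2 * D ^+ 2 =
  \int[P]_w (c1 * (f (x k w) - fstar) + c2 * W k w + c3).
  rewrite [RHS]RintegralD// [X in _ = X + _]RintegralD// mean_cst !RintegralZl//.
  by rewrite /c2 /c3; ring.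
apply: (le_Rintegral measurableT).
- exact: integ (@FA k.+1).
- apply: (integ (k := k.+1)) => w w' ww'.
  by rewrite (FA' w w' ww') (WA ww').
- move=> w _; have [_ _ hs _ hx] := run; rewrite hx.
  have := @frank_wolfe_step _ _ Q f L D (B k) (gam k) (x k w) (h k.+1 w) (s k w)
    cQ diamQ (fun y Qy => df (sub_stencil Qy)) L0 lipQ cf D0 (B0 k) (gam01 k)
    (run_in_Q k w) (hs k w).
  move=> /le_trans; apply; rewrite le_eqVlt; apply/orP; left; apply/eqP.
  by rewrite /c1 /c2 /c3 /W /gam; ring.
Qed.

Lemma mean_gap_bound k : \int[P]_w (f (x k w) - fstar) <=
  32 * n * M / G k + 2 * Num.sqrt n * eps * D.
Proof.
have LM : L * D ^+ 2 <= M by rewrite le_max lexx.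
have M0 : 0 <= M by apply: le_trans LM; rewrite mulr_ge0 ?sqr_ge0 ?ltW.
elim: k => [|k IH]; last first.
  rewrite GS; apply: (gap_recursion n1 (Gn k) D0 LM M0 erefl (B0 k) IH).
    exact: mean_estimator_bound.
  exact: mean_gap_step.
have [h0 _ _ _ _] := run.
have -> : (fun w => f (x 0%N w) - fstar) = (fun=> f x0 - fstar).
  by apply/funext => w; rewrite (h0 w).1.
rewrite mean_cst.
(* [G 0 = 8 * n]; the maximum in [M] makes [4 * M] dominate the initial gap. *)
have -> : 32 * n * M / G 0 = 4 * M.
  rewrite /G add0r -/n; field; have := n1; lra.
have : f x0 - fstar <= M by rewrite le_max lexx orbT.
have : 0 <= 2 * Num.sqrt n * eps * D.
  by rewrite !mulr_ge0 ?sqrtr_ge0 ?ltW.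
lra.
Qed.

Lemma expected_gap_bound N :
  ('E_P[fun w => (f (x N w) - fstar)%R] <=
   (32 * (d%:R * M / (N%:R + 8 * d%:R) + Num.sqrt d%:R * L * D * tau
     + Num.sqrt d%:R * Delta * D / tau))%:E)%E.
Proof.
have fin : (\int[P]_w (f (x N w) - fstar)%:E)%E \is a fin_num.
  exact: integrable_fin_num (integ (@FA N)).
rewrite unlock -(fineK fin) lee_fin; apply: le_trans (mean_gap_bound N) _.
pose S := Num.sqrt n * L * D * tau + Num.sqrt n * Delta * D / tau.
have -> : 2 * Num.sqrt n * eps * D = 2 * S by rewrite /S /eps; ring.
have S0 : 0 <= S.
  by rewrite addr_ge0 ?divr_ge0 ?mulr_ge0 ?sqrtr_ge0 ?ltW.
(* The noise part carries only the factor 2; it is enlarged to 32 to share one constant with the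
   rate term. *)
rewrite [leRHS](_ : _ = 32 * n * M / G N + 32 * S); last by rewrite /S /n /G; ring.
by rewrite lerD2l ler_wpM2r// ler_nat.
Qed.

End Run.

(** * The convergence rate with an absolute constant *)

Theorem theorem2 (R : realType) :
  exists C : R, 0 < C /\
  forall (d : nat) (Q : set 'rV[R]_d) (f delta : 'rV[R]_d -> R)
    (D L Delta tau : R) (x0 : 'rV[R]_d)
    (disp : measure_display) (Omega : measurableType disp)
    (P : probability Omega R) (idx : nat -> Omega -> 'I_d)
    (x h s : nat -> Omega -> 'rV[R]_d),
  (0 < d)%N ->
  0 < tau ->
  compact Q ->
  convex_set Q ->
  0 < D ->
  (forall y z, Q y -> Q z -> enorm (y - z) <= D) ->
  (forall y, stencil_nbhd tau Q y -> differentiable f y) ->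
  0 < L ->
  lipschitz_gradient_on (stencil_nbhd tau Q) f L ->
  convex_on Q f ->
  0 < Delta ->
  (forall y, stencil_nbhd tau Q y -> `|delta y| ^+ 2 <= Delta ^+ 2) ->
  Q x0 ->
  uniform_indices P idx ->
  independent_indices P idx ->
  fw_jaguar Q tau (noisy f delta) (fun k => 4 / (k%:R + 8 * d%:R)) x0 idx x h s ->
  forall N : nat,
  let fstar := min_on Q f in
  let F0 := f x0 - fstar in
  ('E_P[fun w => (f (x N w) - fstar)%R] <=
   (C * (d%:R * Num.max (L * D ^+ 2) F0 / (N%:R + 8 * d%:R)
         + Num.sqrt d%:R * L * D * tau
         + Num.sqrt d%:R * Delta * D / tau))%:E)%E.
Proof.
exists 32; split=> // d Q f delta D L Delta tau x0 disp Omega P idx x h s.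
move=> d0 tau0 _ cQ D0 diamQ df L0 lip cf Delta0 hdelta Qx0 unif indep run N.
exact: (expected_gap_bound d0 tau0 cQ D0 diamQ df L0 lip cf Delta0 hdelta Qx0
  unif indep run).
Qed.
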